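(* Let $K$ be a finite connected simplicial complex of dimension $n$. Then the second barycentric subdivision $K''$ of $K$ can be covered by $n+1$ strong collapsible subcomplexes.
   Context: A vertex $v$ of a simplicial complex $K$ is dominated by a vertex $v' \neq v$ if every maximal simplex of $K$ that contains $v$ also contains $v'$. In that case there is an elementary strong collapse from $K$ to $K \setminus v$, where $K\setminus v$ denotes the subcomplex of all simplices of $K$ not containing $v$. A strong collapse from $K$ to $L$ is a (finite, possibly empty) sequence of elementary strong collapses starting in $K$ and ending in $L$. A complex is strong collapsible if it strong collapses to a single vertex. A complex is covered by a family of subcomplexes if it is their union. *)

(* Defs.v *)
From mathcomp Require Import all_boot.

Set Implicit Arguments.
Unset Strict Implicit.
Unset Printing Implicit Defensive.

Section SimplicialComplexes.
Variable V : finType.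
Implicit Types (K L : {set {set V}}) (s t : {set V}) (v w : V).

(* Abstract simplicial complexes, given by their set of (nonempty) simplices.
   The vertices of K are the v with [set v] \in K; they need not exhaust V, so
   that all subcomplexes of K live over the same type. *)
Definition simplicial_complex K : bool :=
  (set0 \notin K) &&
  [forall s in K, forall t : {set V}, (t != set0) && (t \subset s) ==> (t \in K)].

Definition subcomplex L K : bool := simplicial_complex L && (L \subset K).

(* The empty complex has no dimension in nat: its max is 0, never n.+1. *)
Definition has_dim K (n : nat) : Prop := \max_(s in K) #|s| = n.+1.

Definition connected_complex K : bool :=
  [forall v, forall w, ([set v] \in K) && ([set w] \in K) ==>
     connect [rel x y | [set x; y] \in K] v w].

Definition maximal_simplex K s : bool := maxset (fun t => t \in K) s.

Definition dominated_by K v v' : bool :=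
  [&& [set v] \in K, v' != v &
      [forall s, maximal_simplex K s && (v \in s) ==> (v' \in s)]].

Definition delete_vertex K v : {set {set V}} := [set s in K | v \notin s].

Definition elementary_strong_collapse K L : bool :=
  [exists v, [exists v', dominated_by K v v'] && (L == delete_vertex K v)].

(* connect is the reflexive transitive closure. *)
Definition strong_collapse K L : bool := connect elementary_strong_collapse K L.

Definition strong_collapsible K : bool :=
  [exists v, strong_collapse K [set [set v]]].

(* The vertices of the barycentric subdivision are the simplices of K, and its
   simplices are the nonempty chains of simplices of K under inclusion. *)
Definition sd K : {set {set {set V}}} :=
  [set c : {set {set V}} | [&& c != set0, c \subset K &
     [forall s in c, forall t in c, (s \subset t) || (t \subset s)]]].

End SimplicialComplexes.

(* Main.v *)
(** Write M = K''.  The closed stars in M of the vertices {s}, for s a simplex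
    of K, cover M, and if s and t are distinct of the same dimension then the
    stars of {s} and {t} share no vertex.  Fix a dimension and start from one
    of its stars.  As M is connected, some edge of M leads from the subcomplex
    built so far to a new vertex y; attach that edge together with the star
    containing y, or with y alone if y lies in no remaining star.  The piece
    attached at each step is a cone, so it strong collapses onto its apex, then
    onto y, and finally into the previous subcomplex. *)

Require Import Defs.
From mathcomp Require Import all_boot.

Set Implicit Arguments.
Unset Strict Implicit.
Unset Printing Implicit Defensive.

(** * Strong collapses onto full subcomplexes *)

Section StrongCollapse.
Variable V : finType.
Implicit Types (K L M X B : {set {set V}}) (A U s t : {set V}) (a b v w x y : V).

Lemma simplicial_complexP K :
  reflect (set0 \notin K /\
           forall s t, s \in K -> t != set0 -> t \subset s -> t \in K)
          (simplicial_complex K).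
Proof.
apply: (iffP andP) => -[K0 Ksub]; split=> //.
  move=> s t sK t0 ts; move/forallP/(_ s): Ksub; rewrite sK => /forallP/(_ t).
  by rewrite t0 ts.
apply/forallP => s; apply/implyP => sK; apply/forallP => t.
by apply/implyP => /andP[]; apply: Ksub sK.
Qed.

Lemma complex_vertex K s v :
  simplicial_complex K -> s \in K -> v \in s -> [set v] \in K.
Proof.
move=> /simplicial_complexP[_ Ksub] sK vs; apply: Ksub sK _ _.
  by rewrite -card_gt0 cards1.
by rewrite sub1set.
Qed.

Lemma subset_set1 s v : s != set0 -> s \subset [set v] -> s = [set v].
Proof. by move=> s0; rewrite subset1 (negPf s0) orbF => /eqP. Qed.

(** By maximality, a maximal simplex [s] through [v] equals [w |: s], so it contains [w]. *)
Lemma collapse_dominated K v w :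
    [set v] \in K -> w != v ->
    (forall s, s \in K -> v \in s -> w |: s \in K) ->
  strong_collapse K (delete_vertex K v).
Proof.
move=> vK wv dom; apply: connect1; rewrite /elementary_strong_collapse.
apply/existsP; exists v; rewrite eqxx andbT; apply/existsP; exists w.
apply/and3P; split=> //; apply/forallP => s; apply/implyP => /andP[smax vs].
have /maxsetP[sK smaxl] := smax.
by rewrite -(smaxl _ (dom _ sK vs) (subsetUr _ _)) setU11.
Qed.

Definition induced K U := [set s in K | s \subset U].

Lemma induced_complex K U :
  simplicial_complex K -> simplicial_complex (induced K U).
Proof.
move=> /simplicial_complexP[K0 Ksub]; apply/simplicial_complexP.
rewrite inE (negPf K0); split=> // s t; rewrite !inE => /andP[sK sU] t0 ts.
by rewrite (Ksub s) //=; apply: subset_trans sU.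
Qed.

Lemma induced_induced K U U' :
  U' \subset U -> induced (induced K U) U' = induced K U'.
Proof.
move=> UU'; apply/setP => s; rewrite !inE -andbA; congr (_ && _); apply: andb_idl => sU'.
exact: subset_trans UU'.
Qed.

(** The points outside [U] are deleted one at a time, all dominated by the same [w], which lies in
    [U] and so is never deleted itself. *)
Lemma collapse_onto_induced K w U :
    simplicial_complex K -> w \in U ->
    (forall v s, v \notin U -> s \in K -> v \in s -> w |: s \in K) ->
  strong_collapse K (induced K U).
Proof.
have [m] := ubnP #|~: U|; elim: m => // m IHm in U *.
move=> Um Kc wU dom; have [U_full|[v vU]] := set_0Vmem (~: U).
  have -> : induced K U = K.
    by apply/setP => s; rewrite inE -[U]setCK U_full setC0 subsetT andbT.
  exact: connect0.
have vw : v != w by apply: contraTneq vU => ->; rewrite inE negbK.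
have vU' : v \notin U by rewrite inE in vU.
have UvU : U = (v |: U) :\ v by rewrite setU1K.
have step : strong_collapse K (induced K (v |: U)).
  apply: IHm => //; last by move=> u s; rewrite !inE negb_or => /andP[_]; apply: dom.
    by move: Um; rewrite (cardsD1 v (~: U)) vU setCU setIC -setDE.
  by rewrite inE wU orbT.
apply: connect_trans step _.
have -> : induced K U = delete_vertex (induced K (v |: U)) v.
  by apply/setP => s; rewrite !inE -andbA {1}UvU subsetD1.
(* A point that is not a vertex of [K] cannot be dominated, but deleting it changes nothing. *)
have [vK|vK] := boolP ([set v] \in K); last first.
  suff -> : delete_vertex (induced K (v |: U)) v = induced K (v |: U).
    exact: connect0.
  apply/setP => s; rewrite !inE andb_idr // => /andP[sK _]; apply: contra vK.
  exact: complex_vertex.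
apply: (@collapse_dominated _ _ w); first by rewrite inE vK sub1set setU11.
  by rewrite eq_sym.
move=> s; rewrite !inE => /andP[sK sU] vs; rewrite (dom v) //=.
by rewrite subUset sub1set !inE wU orbT.
Qed.

Definition vertices K : {set V} := [set v | [set v] \in K].

Lemma sub_vertices K s :
  simplicial_complex K -> s \in K -> s \subset vertices K.
Proof.
by move=> Kc sK; apply/subsetP => v vs; rewrite inE (complex_vertex Kc sK).
Qed.

(** * Cones and their attachment along an edge *)

Definition cone B a := [/\ simplicial_complex B, [set a] \in B &
  forall s, s \in B -> a |: s \in B].

Lemma cone_strong_collapsible B a : cone B a -> strong_collapsible B.
Proof.
move=> [Bc aB Ba]; apply/existsP; exists a.
have -> : [set [set a]] = induced B [set a].
  apply/setP => s; rewrite !inE.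
  apply/eqP/andP => [->|[sB]]; first by rewrite aB.
  apply: subset_set1; apply: contraTneq sB => ->.
  by case/simplicial_complexP: Bc.
apply: (@collapse_onto_induced _ a) => //; first by rewrite inE.
by move=> v s _ sB _; apply: Ba.
Qed.

Lemma sub_set2 s x y : s != set0 -> s \subset [set x; y] ->
  [\/ s = [set x], s = [set y] | s = [set x; y]].
Proof.
move=> s0 sxy; have in_s z : z \in s -> z = x \/ z = y.
  by move=> zs; have:= subsetP sxy z zs; rewrite !inE => /orP[]/eqP; [left|right].
have [xs|xs] := boolP (x \in s); last first.
  apply/Or32/subset_set1 => //; apply/subsetP => z zs; rewrite inE.
  by case: (in_s z zs) xs => [<-|->//]; rewrite zs.
have [ys|ys] := boolP (y \in s); last first.
  apply/Or31/subset_set1 => //; apply/subsetP => z zs; rewrite inE.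
  by case: (in_s z zs) ys => [->//|<-]; rewrite zs.
by apply: Or33; apply/eqP; rewrite eqEsubset sxy subUset !sub1set xs ys.
Qed.

(** In use, [X] and [B] share no vertex and [[set x; y]] is a bridge between them. *)
Definition attach X B x y := [set x; y] |: (X :|: B).

Section Attach.
Variables (X B : {set {set V}}) (a x y : V).
Hypotheses (Xc : simplicial_complex X) (Ba : cone B a).
Hypotheses (XB : [disjoint vertices X & vertices B]).
Hypotheses (xX : [set x] \in X) (yB : [set y] \in B).

Lemma attach_complex : simplicial_complex (attach X B x y).
Proof.
have [/simplicial_complexP[B0 Bsub] _ _] := Ba.
have /simplicial_complexP[X0 Xsub] := Xc.
apply/simplicial_complexP; split.
  rewrite !inE (negPf X0) (negPf B0) !orbF.
  by apply/eqP => /setP/(_ x); rewrite !inE eqxx.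
move=> s t; rewrite !inE => /or3P[/eqP-> | sX | sB] t0 ts.
- by case: (sub_set2 t0 ts) => ->; rewrite ?xX ?yB ?eqxx ?orbT.
- by rewrite (Xsub s) ?orbT.
- by rewrite (Bsub s) ?orbT.
Qed.

Lemma attach_vertices : vertices (attach X B x y) = vertices X :|: vertices B.
Proof.
apply/setP => z; rewrite !inE; apply/orb_idl => /eqP/setP/(_ x).
by rewrite !inE eqxx => /eqP <-; rewrite xX.
Qed.

Let Bc : simplicial_complex B. Proof. by case: Ba. Qed.

Let notin_B z : z \in vertices X -> z \notin vertices B.
Proof. by move=> zX; rewrite (disjointFr XB zX). Qed.

Let attach_cases v s : v \notin vertices X -> v \in s -> s \in attach X B x y ->
  s = [set x; y] /\ v = y \/ s \in B.
Proof.
move=> vX vs; rewrite !inE => /or3P[/eqP s_xy | sX | ->]; last by right.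
  left; move: vs; rewrite s_xy !inE => /orP[]/eqP v_eq //.
  by rewrite v_eq inE xX in vX.
by case/negP: vX; apply: subsetP vs; apply: sub_vertices.
Qed.

(** The bridge and every simplex of [B] have a vertex in [B], hence outside [X]. So [X] is a full
    subcomplex and can be the target of [collapse_onto_induced]. *)
Lemma induced_attach : induced (attach X B x y) (vertices X) = X.
Proof.
apply/setP => s; rewrite inE; apply/andP/idP => [[sA sVX]|sX]; last first.
  by rewrite !inE sX orbT sub_vertices.
move: sA; rewrite !inE => /or3P[/eqP s_xy | // | sB].
  have /notin_B : y \in vertices X.
    by rewrite (subsetP sVX) // s_xy !inE eqxx orbT.
  by rewrite inE yB.
have [s0|[v vs]] := set_0Vmem s.
  by case/simplicial_complexP: Bc; rewrite -s0 sB.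
have := notin_B (subsetP sVX v vs).
by rewrite (subsetP (sub_vertices Bc sB)).
Qed.

Lemma attach_collapse : strong_collapse (attach X B x y) X.
Proof.
have [_ aB aBB] := Ba.
set A := attach X B x y; set VX := vertices X.
(* [U1] and [U2] are the points kept after the first and the second of three rounds of deletions; if
   [a] is [y], the second round is empty. *)
pose U1 := a |: (y |: VX); pose U2 := y |: VX.
have U21 : U2 \subset U1 by apply: subsetUr.
have VX2 : VX \subset U2 by apply: subsetUr.
have sub_B s v : s \in B -> s \subset U1 -> v \in s -> v = a \/ v = y.
  move=> sB sU1 vs; have := subsetP sU1 v vs; rewrite 2!in_setU1.
  case/or3P => [/eqP|/eqP|/notin_B]; [by left|by right|].
  by rewrite (subsetP (sub_vertices Bc sB)).
(* Both ends of the bridge are in [U1], so a simplex with a vertex outside [U1] lies in [B], where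
   [a] can be added. *)
have step1 : strong_collapse A (induced A U1).
  apply: (@collapse_onto_induced _ a); rewrite ?setU11 //.
    exact: attach_complex.
  move=> v s; rewrite 2!in_setU1 !negb_or => /and3P[va vy vX] sA vs.
  have [[_ v_y]|sB] := attach_cases vX vs sA; first by rewrite v_y eqxx in vy.
  by rewrite !inE aBB ?orbT.
(* Of [B] only [a] and [y] remain; adding [y] to a simplex of [B] through [a] gives [[set a; y]],
   which is in the cone [B]. *)
have step2 : strong_collapse (induced A U1) (induced A U2).
  rewrite -(induced_induced A U21).
  apply: (@collapse_onto_induced _ y); rewrite ?setU11 //.
    exact/induced_complex/attach_complex.
  move=> v s; rewrite in_setU1 negb_or => /andP[vy vX].
  rewrite [s \in _]inE => /andP[sA sU1] vs.
  have [[_ v_y]|sB] := attach_cases vX vs sA; first by rewrite v_y eqxx in vy.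
  have va : v = a by case: (sub_B s v) => // v_y; rewrite v_y eqxx in vy.
  have -> : y |: s = a |: [set y].
    apply/setP => z; rewrite !inE orbC; apply/orb_id2r => zy.
    apply/idP/eqP => [zs|->]; last by rewrite -va.
    by case: (sub_B s z) => // z_y; rewrite z_y eqxx in zy.
  by rewrite inE !inE aBB // !orbT subUset !sub1set !inE !eqxx orbT.
(* The only vertex left outside [X] is [y], and it lies only in [[set y]] and in the bridge. *)
have step3 : strong_collapse (induced A U2) X.
  rewrite -[X in strong_collapse _ X]induced_attach -(induced_induced _ VX2).
  apply: (@collapse_onto_induced _ x); rewrite ?inE //.
    exact/induced_complex/attach_complex.
  move=> v s vX; rewrite [s \in _]inE => /andP[sA sU2] vs.
  have -> : x |: s = [set x; y].
    have [[-> _]|sB] := attach_cases vX vs sA; first by rewrite setUA setUid.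
    suff s_y z : z \in s -> z = y.
      congr (_ |: _); apply/setP => z; rewrite inE.
      by apply/idP/eqP => [/s_y //|->]; rewrite -(s_y v vs).
    move=> zs; have := subsetP sU2 z zs; rewrite in_setU1.
    case/orP => [/eqP //|/notin_B].
    by rewrite (subsetP (sub_vertices Bc sB)).
  by rewrite inE setU11 subUset !sub1set !inE eqxx xX orbT.
exact: connect_trans step1 (connect_trans step2 step3).
Qed.

End Attach.

(** * Closed stars, and edges leaving a set of vertices *)

Definition star M a := [set s in M | a |: s \in M].

Lemma star_vertices M a v :
  simplicial_complex M -> (v \in vertices (star M a)) = ([set a; v] \in M).
Proof.
move=> Mc; rewrite !inE; apply: andb_idl => avM.
by apply: complex_vertex avM _; rewrite // !inE eqxx orbT.
Qed.

Lemma star_cone M a : simplicial_complex M -> [set a] \in M -> cone (star M a) a.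
Proof.
move=> /simplicial_complexP[M0 Msub] aM; split.
- apply/simplicial_complexP; rewrite inE (negPf M0); split=> // s t.
  rewrite !inE => /andP[sM asM] t0 ts.
  apply/andP; split; first exact: Msub ts.
  apply: Msub asM _ _; last exact: setUS.
  by apply/set0Pn; exists a; rewrite setU11.
- by rewrite inE setUid aM.
- by move=> s; rewrite !inE => /andP[_ asM]; rewrite setUA setUid asM.
Qed.

(** Lets a lone vertex be attached in the same way as a star. *)
Lemma vertex_cone y : cone [set [set y]] y.
Proof.
split; rewrite ?inE //; last by move=> s; rewrite !inE => /eqP ->; rewrite setUid.
apply/simplicial_complexP; rewrite inE; split=> [|s t].
  by rewrite eq_sym -card_gt0 cards1.
by rewrite !inE => /eqP -> t0 /subset_set1 ->.
Qed.

(** The path is followed from [x0] to its first step out of [S]. *)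
Lemma boundary_edge M x0 z (S : {set V}) :
    connect [rel x y | [set x; y] \in M] x0 z -> x0 \in S -> z \notin S ->
  exists x y, [/\ x \in S, y \notin S & [set x; y] \in M].
Proof.
move=> /connectP[p]; elim: p x0 => [|y p IHp] x0 /=.
  by move=> _ -> ->.
move=> /andP[xyM pM] zE xS zS; have [yS|yS] := boolP (y \in S).
  exact: IHp pM zE yS zS.
by exists x0, y.
Qed.

(** * Growing a strong collapsible complex until it contains disjoint stars *)

Section Grow.
Variables (M : {set {set V}}) (A : {set V}).
Hypotheses (Mc : simplicial_complex M) (Mconn : connected_complex M).
Hypothesis AM : {subset A <= vertices M}.
Hypothesis star_inj : {in A &, forall a b v,
  [set a; v] \in M -> [set b; v] \in M -> a = b}.

(** The invariant of the growth: no star is partly absorbed, so a star not yet in [X] is disjoint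
    from it, as attaching requires. *)
Definition stars_split X :=
  {in A, forall a, star M a \subset X \/ [disjoint vertices (star M a) & vertices X]}.

Lemma star_split a : a \in A -> stars_split (star M a).
Proof.
move=> aA b bA; have [->|ba] := eqVneq b a; first by left.
right; apply/pred0P => v /=; apply: contra_neqF ba => /andP[].
by rewrite !star_vertices //; apply: star_inj.
Qed.

Lemma vertex_split y : {in A, forall a, y \notin vertices (star M a)} ->
  stars_split [set [set y]].
Proof.
move=> yA a aA; right; apply/pred0P => v /=; apply/negP => /andP[va].
by rewrite !inE => /eqP/set1_inj v_y; move: (yA a aA); rewrite -v_y va.
Qed.

(** The final disjunction records the origin of [B], from which [grow] derives that [B] is disjoint
    from [X]. *)
Lemma cone_at_vertex y : [set y] \in M -> exists B b,
  [/\ cone B b, B \subset M, [set y] \in B, stars_split B &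
      B = [set [set y]] \/ exists2 a, a \in A & B = star M a].
Proof.
move=> yM; have [/existsP[a /andP[aA ya]]|noA] :=
  boolP [exists a in A, y \in vertices (star M a)].
  exists (star M a), a; split; last by right; exists a.
  - by apply: star_cone => //; have := AM aA; rewrite inE.
  - by apply/subsetP => s; rewrite inE => /andP[].
  - by rewrite inE in ya.
  - exact: star_split.
exists [set [set y]], y; split; [exact: vertex_cone| | |..].
- by rewrite sub1set.
- by rewrite inE.
- apply: vertex_split => a aA; apply: contra noA => ya.
  by apply/existsP; exists a; rewrite aA.
- by left.
Qed.

(** Induction on the number of points that are not vertices of [X]. The vertex [x0] is where a path
    out of [X] starts. *)
Lemma grow X x0 : subcomplex X M -> strong_collapsible X -> [set x0] \in X ->
    stars_split X ->
  exists L, [/\ subcomplex L M, strong_collapsible L &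
                {in A, forall a, star M a \subset L}].
Proof.
have [m] := ubnP #|~: vertices X|; elim: m => // m IHm in X *.
move=> Xm XM Xcoll x0X Xsplit.
have [/forall_inP allA|] := boolP [forall a in A, star M a \subset X].
  by exists X.
rewrite negb_forall_in => /exists_inP[a aA aX].
have aM : [set a] \in M by have := AM aA; rewrite inE.
have /andP[Xc XsubM] := XM.
have a_notX : a \notin vertices X.
  have [/idPn//|/disjointFr->//] := Xsplit a aA.
  by rewrite star_vertices // setUid.
have [x [y [xX yX xyM]]] : exists x y,
    [/\ x \in vertices X, y \notin vertices X & [set x; y] \in M].
  apply: (boundary_edge (x0 := x0)) a_notX; last by rewrite inE.
  move/forallP/(_ x0)/forallP/(_ a)/implyP: Mconn; apply.
  by rewrite (subsetP XsubM) // aM.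
have yM : [set y] \in M by apply: complex_vertex xyM _; rewrite // !inE eqxx orbT.
have [B [b [Bb BM yB Bsplit Bcase]]] := cone_at_vertex yM.
(* If [B] is a star, it is not inside [X] because [y] is not, so the invariant makes it disjoint
   from [X]. *)
have XB : [disjoint vertices X & vertices B].
  rewrite disjoint_sym.
  case: Bcase => [->|[c cA Bc]].
    apply/pred0P => v /=; apply/negP => /andP[].
    by rewrite inE => /set1P/set1_inj -> yX'; rewrite yX' in yX.
  rewrite Bc in yB *; have [/subsetP/(_ _ yB)|//] := Xsplit c cA.
  by move: yX; rewrite inE => /negPf ->.
have xX' : [set x] \in X by rewrite inE in xX.
have Vattach : vertices (attach X B x y) = vertices X :|: vertices B.
  exact: attach_vertices.
apply: (IHm (attach X B x y)).
- rewrite ltnS in Xm; apply: leq_trans Xm; apply: proper_card.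
  rewrite properC Vattach.
  apply/properP; split; first exact: subsetUl.
  by exists y => //; rewrite !inE yB orbT.
- apply/andP; split; first exact: attach_complex Bb _ _.
  by rewrite !subUset sub1set xyM XsubM BM.
- have [v Xv] := existsP Xcoll; apply/existsP; exists v.
  apply: connect_trans Xv; exact: attach_collapse Bb _ _ _.
- by rewrite !inE x0X orbT.
move=> c cA; rewrite Vattach.
(* A star disjoint from both [X] and [B] stays disjoint, since the bridge adds no vertex. *)
have [cX|cX] := Xsplit c cA.
  by left; apply: subset_trans cX _; rewrite /attach setUCA subsetUl.
have [cB|cB] := Bsplit c cA.
  by left; apply: subset_trans cB _; rewrite /attach setUA subsetUr.
by right; rewrite -setI_eq0 setIUr !disjoint_setI0 ?setU0.
Qed.

Lemma stars_in_strong_collapsible : A != set0 ->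
  exists L, [/\ subcomplex L M, strong_collapsible L &
                {in A, forall a, star M a \subset L}].
Proof.
move=> /set0Pn[a aA]; have aM : [set a] \in M by have := AM aA; rewrite inE.
have acone := star_cone Mc aM; have [ac aa _] := acone.
apply: grow aa (star_split aA); last exact: cone_strong_collapsible acone.
by rewrite /subcomplex ac; apply/subsetP => s; rewrite inE => /andP[].
Qed.

End Grow.
End StrongCollapse.

(** * Barycentric subdivision and its connectedness *)

Section Subdivision.
Variable V : finType.
Implicit Types (K : {set {set V}}) (s t : {set V}) (c : {set {set V}}).

Lemma sdP K c :
  reflect [/\ c != set0, c \subset K &
             {in c &, forall s t, s \subset t \/ t \subset s}] (c \in sd K).
Proof.
rewrite inE; apply: (iffP and3P) => -[c0 cK chain]; split=> //.
  by move=> s t sc tc; apply/orP; apply: (forall_inP (forall_inP chain s sc)).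
by apply/forall_inP => s sc; apply/forall_inP => t tc; apply/orP/chain.
Qed.

Lemma sd_complex K : simplicial_complex (sd K).
Proof.
apply/simplicial_complexP; split; first by rewrite inE eqxx.
move=> c d /sdP[_ cK chain] d0 /subsetP dc; apply/sdP; split=> //.
  by apply: subset_trans cK; apply/subsetP.
by move=> s t /dc sc /dc tc; apply: chain.
Qed.

Lemma sd_edge K s t : s \in K -> t \in K -> s \subset t -> [set s; t] \in sd K.
Proof.
move=> sK tK st; apply/sdP; split; first by apply/set0Pn; exists s; rewrite set21.
  by rewrite subUset !sub1set sK.
by move=> _ _ /set2P[]-> /set2P[]->; rewrite ?st ?subxx; auto.
Qed.

Lemma sd_vertex K s : ([set s] \in sd K) = (s \in K).
Proof.
apply/idP/idP => [/sdP[_]|sK]; first by rewrite sub1set.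
by rewrite -[[set s]]setUid; apply: sd_edge.
Qed.

(** A simplex is joined in [sd K] to each of its vertices, and an edge of [K] becomes a path from
    [[set v]] through [[set v; y]] to [[set y]]. *)
Lemma sd_connected K :
  simplicial_complex K -> connected_complex K -> connected_complex (sd K).
Proof.
move=> Kc Kconn; set e := [rel s t | [set s; t] \in sd K].
have e_sym : connect_sym e.
  by apply: sym_connect_sym => s t; rewrite /= setUC.
have to_vertex s v : s \in K -> v \in s -> connect e [set v] s.
  move=> sK vs; apply: connect1; apply: sd_edge; rewrite ?sub1set //.
  exact: complex_vertex vs.
have vertex_path v w :
    connect [rel x y | [set x; y] \in K] v w -> connect e [set v] [set w].
  move=> /connectP[p]; elim: p v => [|y p IHp] v /= => [_ -> //|].
  move=> /andP[vyK yp] wE; apply: connect_trans (IHp _ yp wE).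
  apply: (@connect_trans _ _ [set v; y]); first by rewrite to_vertex ?set21.
  by rewrite e_sym to_vertex ?set22.
apply/forallP => s; apply/forallP => t; apply/implyP; rewrite !sd_vertex.
case/andP=> sK tK; have [K0 _] := simplicial_complexP _ Kc.
have [|v vs] := set0Pn s _; first by apply: contraNneq K0 => <-.
have [|w wt] := set0Pn t _; first by apply: contraNneq K0 => <-.
apply: (@connect_trans _ _ [set v]); first by rewrite e_sym to_vertex.
apply: (@connect_trans _ _ [set w]); last exact: to_vertex.
apply: vertex_path; move/forallP/(_ v)/forallP/(_ w)/implyP: Kconn; apply.
by rewrite (complex_vertex Kc sK) ?(complex_vertex Kc tK).
Qed.

End Subdivision.

(** * Stars of simplices of [K] in the second subdivision *)

Section SecondSubdivision.
Variable V : finType.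
Implicit Types (K : {set {set V}}) (s t : {set V}) (c : {set {set V}})
  (C : {set {set {set V}}}).

(** [[set s]] and [c] are comparable, and a nonempty [c] inside [[set s]] is [[set s]] itself. *)
Lemma sd_set1_edge K s c : [set [set s]; c] \in sd (sd K) -> s \in c.
Proof.
case/sdP=> _ /subsetP sub chain.
have /sdP[c0 _ _] := sub _ (set22 _ _).
have [] := chain _ _ (set21 _ _) (set22 _ _); first by rewrite sub1set.
by move/(subset_set1 c0) ->; rewrite inE.
Qed.

(** Both [s] and [t] lie in the chain [c], and nested sets of equal size coincide. This yields
    [star_inj] for the simplices of one dimension. *)
Lemma sd_same_card_inj K s t c : #|s| = #|t| ->
  [set [set s]; c] \in sd (sd K) -> [set [set t]; c] \in sd (sd K) -> s = t.
Proof.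
move=> st scK /sd_set1_edge tc; have sc := sd_set1_edge scK.
have /sdP[_ /subsetP/(_ _ (set22 _ _))/sdP[_ _ chain] _] := scK.
have [sub|sub] := chain s t sc tc.
  by apply/eqP; rewrite eqEcard sub st leqnn.
by apply/esym/eqP; rewrite eqEcard sub st leqnn.
Qed.

(** [C] is a chain of chains. Any [s] in its smallest member lies in all members, so [[set s]] can
    be added to [C]. *)
Lemma sd_sd_star K C : C \in sd (sd K) ->
  exists2 s, s \in K & C \in star (sd (sd K)) [set s].
Proof.
move=> CK; have /sdP[/set0Pn[c0 c0C] /subsetP Csub chain] := CK.
pose c := [arg min_(c < c0 in C) #|c|].
have [cC c_min] : c \in C /\ forall d, d \in C -> c \subset d.
  rewrite /c; case: arg_minnP => // {}c cC cmin; split=> // d dC.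
  have [//|dc] := chain c d cC dC.
  suff -> : d = c by [].
  by apply/eqP; rewrite eqEcard dc cmin.
have /sdP[/set0Pn[s sc] cK _] := Csub c cC.
have sK := subsetP cK s sc.
have s_sub d : d \in C -> [set s] \subset d.
  by move=> /c_min cd; rewrite sub1set (subsetP cd).
exists s => //; rewrite inE CK; apply/sdP; split.
- by apply/set0Pn; exists [set s]; rewrite setU11.
- by rewrite subUset sub1set sd_vertex sK; apply/subsetP.
move=> d d' /setU1P[->|dC] /setU1P[->|d'C]; first by left.
- by left; apply: s_sub.
- by right; apply: s_sub.
- exact: chain.
Qed.

(** Any [i.+1] vertices of a simplex of top dimension span a face. *)
Lemma simplex_of_dim K n i : simplicial_complex K -> has_dim K n -> i <= n ->
  exists2 s, s \in K & #|s| = i.+1.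
Proof.
move=> /simplicial_complexP[_ Ksub] Kn le_in.
have [t tK tn] : exists2 t, t \in K & #|t| = n.+1.
  have K_gt0 : 0 < #|K|.
    rewrite card_gt0; apply/eqP => K0.
    by move: Kn; rewrite /has_dim K0 big_set0.
  by have [t tK] := eq_bigmax_cond (fun s => #|s|) K_gt0; exists t; rewrite -?Kn.
have : 0 < #|[set s : {set V} | s \subset t & #|s| == i.+1]|.
  by rewrite cards_draws bin_gt0 tn.
case/card_gt0P=> s; rewrite inE => /andP[st /eqP si]; exists s => //.
by apply: Ksub tK _ st; rewrite -card_gt0 si.
Qed.

End SecondSubdivision.

Theorem proposition2p7 (V : finType) (K : {set {set V}}) (n : nat)
    (K_complex : simplicial_complex K) (K_connected : connected_complex K)
    (K_dim : has_dim K n) :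
  exists L : 'I_n.+1 -> {set {set {set {set V}}}},
    (forall i : 'I_n.+1, subcomplex (L i) (sd (sd K)) /\ strong_collapsible (L i))
    /\ \bigcup_(i < n.+1) L i = sd (sd K).
Proof.
have K'_connected := sd_connected K_complex K_connected.
have K''_connected := sd_connected (sd_complex K) K'_connected.
(* A simplex [s] of dimension [i] has [i.+1] vertices and gives the vertex [[set s]] of the second
   subdivision. *)
pose A (i : 'I_n.+1) := [set [set s] | s in K & #|s| == i.+1].
(* The properties are boolean so that [xchoose] can select a complex for each [i]. *)
have part i : exists L, [&& subcomplex L (sd (sd K)), strong_collapsible L &
    [forall a in A i, star (sd (sd K)) a \subset L]].
  have [] := @stars_in_strong_collapsible _ (sd (sd K)) (A i).
  - exact: sd_complex.
  - exact: K''_connected.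
  - by move=> _ /imsetP[s /setIdP[sK _] ->]; rewrite inE !sd_vertex.
  - move=> _ _ /imsetP[s /setIdP[_ /eqP si] ->] /imsetP[t /setIdP[_ /eqP ti] ->] c.
    by move=> sc tc; rewrite (sd_same_card_inj _ sc tc) // si ti.
  - have [s sK si] := simplex_of_dim K_complex K_dim (ltn_ord i : i <= n).
    by apply/set0Pn; exists [set s]; apply: imset_f; rewrite inE sK si eqxx.
  by move=> L [LK'' Lcoll /forall_inP LA]; exists L; apply/and3P.
exists (fun i => xchoose (part i)); split=> [i|].
  by have /and3P[] := xchooseP (part i).
apply/eqP; rewrite eqEsubset; apply/andP; split.
  apply/bigcupsP => i _; have /and3P[] := xchooseP (part i).
  by case/andP.
apply/subsetP => C /sd_sd_star[s sK Cs].
have s_gt0 : 0 < #|s|.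
  rewrite card_gt0; case/simplicial_complexP: K_complex => K0 _.
  by apply: contraNneq K0 => <-.
(* The index of the piece containing [C] is the dimension of [s]; as [s] is nonempty, the
   predecessor is not truncated. *)
have s_le : #|s|.-1 < n.+1.
  by rewrite prednK // -K_dim leq_bigmax_cond.
apply/bigcupP; exists (Ordinal s_le) => //.
have /and3P[_ _ /forall_inP/(_ [set s])] := xchooseP (part (Ordinal s_le)).
move=> sub; apply: subsetP Cs; apply: sub.
by apply: imset_f; rewrite inE sK /= prednK.
Qed.
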